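(* Let $\beta>0$. Every G-gamma-MID($\beta$) distribution on $\mathbb{R}$ is G-MID. That is, if $e^{-\psi}$ is a distribution function on $\mathbb{R}$, where $\psi:\mathbb{R}\to[0,\infty]$, then the distribution with distribution function $\dfrac{1}{1+\beta\log(1+\psi(x))}$ is geometrically max-infinitely divisible.
   Context: All distributions are on $\mathbb{R}$; d.f. means (cumulative) distribution function; conventions $e^{-\infty}=0$, $1/\infty=0$, $\log\infty=\infty$. A d.f. $F$ is max-infinitely divisible (MID) if $F^{t}$ is a d.f. for every $t>0$ (always true on $\mathbb{R}$). A d.f. is geometrically max-infinitely divisible (G-MID) if it has the form $\dfrac{1}{1+\eta(x)}$, where $\eta:\mathbb{R}\to[0,\infty]$ is such that $e^{-\eta(x)}$ is a MID d.f.; equivalently, a d.f. $F$ is G-MID iff $\exp\{-(\frac{1}{F(x)}-1)\}$ is a MID d.f. For $\beta>0$, a d.f. is G-gamma-MID($\beta$) (geometric gamma max-infinitely divisible) if it has the form $\dfrac{1}{1+\beta\log(1+\psi(x))}$, where $\psi:\mathbb{R}\to[0,\infty]$ is such that $e^{-\psi(x)}$ is a d.f. *)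

(* Defs.v *)
From HB Require Import structures.
From mathcomp Require Import all_boot all_order all_algebra.
From mathcomp Require Import all_classical all_reals all_analysis.

Set Implicit Arguments.
Unset Strict Implicit.
Unset Printing Implicit Defensive.

Import Order.TTheory GRing.Theory Num.Theory.
Import numFieldNormedType.Exports.

Local Open Scope classical_set_scope.
Local Open Scope ring_scope.
Local Open Scope ereal_scope.

(* Distribution functions take values in \bar R, as does the library's [cdf].
   The operations of \bar R then satisfy the conventions
   expeR (- +oo) = 0, +oo^-1 = 0 and lne +oo = +oo. *)

Definition is_df (R : realType) (F : R -> \bar R) : Prop :=
  exists P : probability (measurableTypeR R) R,
    forall x : R, F x = P [set` `]-oo, x]].

Definition is_MID (R : realType) (F : R -> \bar R) : Prop :=
  forall t : R, (0 < t)%R -> is_df (fun x => F x `^ t).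

Definition is_GMID (R : realType) (F : R -> \bar R) : Prop :=
  is_df F /\
  exists eta : R -> \bar R,
    [/\ forall x, 0 <= eta x,
        is_MID (fun x => expeR (- eta x)) &
        forall x, F x = (1 + eta x)^-1].

Definition Ggamma_df (R : realType) (beta : R) (psi : R -> \bar R) (x : R)
  : \bar R := (1 + beta%:E * lne (1 + psi x))^-1.

(* Meant for 0 < beta. *)
Definition is_GgammaMID (R : realType) (beta : R) (F : R -> \bar R) : Prop :=
  is_df F /\
  exists psi : R -> \bar R,
    [/\ forall x, 0 <= psi x,
        is_df (fun x => expeR (- psi x)) &
        forall x, F x = Ggamma_df beta psi x].

(* Main.v *)
Require Import Defs.
From HB Require Import structures.
From mathcomp Require Import all_boot all_order all_algebra.
From mathcomp Require Import all_classical all_reals all_analysis.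

(** A geometrically max-infinitely divisible distribution function has the form
    [1 / (1 + eta)] with [e^{-eta}] max-infinitely divisible.  For the geometric
    gamma form the exponent to take is [eta = beta log (1 + psi)]; it remains to
    see that [1 / (1 + eta)] and, for every [t > 0], the power
    [(e^{-eta})^t = (1 + psi)^{- t beta}] are distribution functions.

    Both are instances of one fact ([is_df_decreasing_of_exponent]): if
    [e^{-psi}] is a distribution function and [h] is a decreasing bijection from
    [[0, +oo[] onto []0, 1]], extended by [h(+oo) = 0], then [h o psi] is a
    distribution function.  Indeed [h o psi = w o e^{-psi}], where
    [w(g) = h(- ln g)] is an increasing bijection of [[0, 1]], hence is
    continuous.  Composition with such a [w] ([is_df_comp]) preserves
    monotonicity, right continuity and the limits 0 and 1 at the two infinities,
    and these properties characterize distribution functions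
    ([is_df_cumulative], [cumulative_of_df]). *)

Import Order.TTheory GRing.Theory Num.Theory.
Import numFieldNormedType.Exports.

Local Open Scope classical_set_scope.
Local Open Scope ring_scope.
Local Open Scope ereal_scope.

(** The witnessing probability is the Lebesgue-Stieltjes measure of [f]. *)
Lemma is_df_cumulative (R : realType) (f : R -> R) :
  {homo f : x y / (x <= y)%R} ->
  (forall a, f x @[x --> a^'+] --> f a) ->
  f x @[x --> -oo%R] --> (0 : R)%R -> f x @[x --> +oo%R] --> (1 : R)%R ->
  is_df (fun x => (f x)%:E).
Proof.
move=> fnd frc f0 f1.
pose fC := isCumulative.Build R _ R f fnd frc.
pose fB := isCumulativeBounded.Build R 0%R 1%R f f0 f1.
pose g : cumulativeBounded (0 : R)%R (1 : R)%R := HB.pack f fC fB.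
exists (lebesgue_stieltjes_measure g) => x.
by rewrite -(cdf_lebesgue_stieltjes_id g x) /cdf /distribution /pushforward /=
  preimage_id.
Qed.

Lemma cumulative_of_df (R : realType) (F : R -> \bar R) : is_df F ->
  exists f : R -> R,
    [/\ forall x, F x = (f x)%:E,
        forall x, (0 <= f x <= 1)%R,
        {homo f : x y / (x <= y)%R} &
        [/\ forall a, f x @[x --> a^'+] --> f a,
        f x @[x --> -oo%R] --> (0 : R)%R &
        f x @[x --> +oo%R] --> (1 : R)%R]].
Proof.
move=> [P FP].
pose idTR : measurableTypeR R -> R := idfun.
pose idM := @isMeasurableFun.Build _ _ _ _ idTR (@measurable_id _ _ setT).
pose X : {RV P >-> R} := HB.pack idTR idM.
have FX x : F x = cdf X x by rewrite FP /cdf /distribution /pushforward preimage_id.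
have Ffin x : cdf X x = (fine (cdf X x))%:E by rewrite fineK// fin_num_measure.
exists (fun x => fine (cdf X x)); split.
- by move=> x; rewrite FX.
- by move=> x; rewrite -!lee_fin -Ffin cdf_ge0 cdf_le1.
- by move=> x y xy; rewrite -lee_fin -!Ffin cdf_nondecreasing.
- split.
  + by move=> a; apply: fine_cvg; rewrite -Ffin; exact: cdf_right_continuous.
  + exact/fine_cvg/cvg_cdfNy0.
  + exact/fine_cvg/cvg_cdfy1.
Qed.

Lemma is_df_comp (R : realType) (w : R -> R) (F : R -> R) :
  {in `[0, 1]%R &, {mono w : x y / (x <= y)%R}} ->
  w 0%R = 0%R -> w 1%R = 1%R -> set_surj `[0%R, 1%R] `[0%R, 1%R] w ->
  is_df (fun x => (F x)%:E) -> is_df (fun x => (w (F x))%:E).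
Proof.
move=> wmono w0 w1 wsurj /cumulative_of_df[f [Ff f01 fnd [frc f0 f1]]].
have {Ff} -> : F = f by apply/funext => x; have [] := Ff x.
have fI x : f x \in `[0%R, 1%R] by rewrite in_itv/= f01.
have /subspace_continuousP wc : {within `[0%R, 1%R], continuous w}.
  by apply: segment_inc_surj_continuous => //; rewrite w0 w1.
(* Since [f] takes its values in [[0, 1]], continuity of [w] within [[0, 1]]
   is enough to pass to the limit, endpoints included. *)
have wf (G : set_system R) (FG : Filter G) (l : R) : l \in `[0%R, 1%R] ->
    f x @[x --> G] --> l -> w (f x) @[x --> G] --> w l.
  move=> lI fl; apply: (@cvg_comp _ _ _ f w _ (within `[0%R, 1%R] (nbhs l))).
    move=> A /= /fl; rewrite /nbhs/=; apply: filterS => x; apply; exact: fI.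
  exact/wc.
apply: is_df_cumulative.
- by move=> x y xy; rewrite wmono ?fI// fnd.
- by move=> a; apply: wf.
- by rewrite -[X in _ --> X]w0; apply: wf => //; rewrite in_itv/= lexx ler01.
- by rewrite -[X in _ --> X]w1; apply: wf => //; rewrite in_itv/= lexx ler01.
Qed.

(** The function [k] is a right inverse of [h] on []0, 1]]; the last branch of
    the [if] in the conclusion is the value 0 of [h] at [+oo], as [-oo] is not
    a value of [psi]. *)
Lemma is_df_decreasing_of_exponent (R : realType) (h k : R -> R)
    (psi : R -> \bar R) :
  {in `[0%R, +oo[ &, {mono h : u v /~ (u <= v)%R}} ->
  (forall u : R, (0 <= u)%R -> (0 < h u)%R) -> h 0%R = 1%R ->
  (forall y : R, (0 < y <= 1)%R -> (0 <= k y)%R /\ h (k y) = y) ->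
  (forall x, 0 <= psi x) -> is_df (fun x => expeR (- psi x)) ->
  is_df (fun x => if psi x is r%:E then (h r)%:E else 0).
Proof.
move=> hmono hpos h0 hk psi0 dfpsi.
(* [w] needs its own value at 0, where [ln] is 0 by default and not [-oo]. *)
pose w (g : R) := if (g <= 0)%R then 0%R else h (- ln g)%R.
pose F x := if psi x is r%:E then expR (- r)%R else 0%R.
have nln g : (g \in `[0%R, 1%R]) -> (- ln g)%R \in `[0%R, +oo[.
  by rewrite !in_itv/= andbT oppr_ge0 => /andP[_ g1]; exact: ln_le0.
have nlnge0 (g : R) : g \in `[0%R, 1%R] -> (0 <= - ln g)%R.
  by move=> /nln; rewrite in_itv/= andbT.
have -> : (fun x => if psi x is r%:E then (h r)%:E else 0) =
          (fun x => (w (F x))%:E).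
  apply/funext => x; rewrite /w /F; case: (psi x) => [r| |] /=; rewrite ?lexx//.
  by rewrite leNgt expR_gt0/= expRK opprK.
apply: is_df_comp.
- move=> a b aI bI; rewrite /w.
  move: (aI) (bI); rewrite !in_itv/= => /andP[a0 _] /andP[b0 _].
  have ha := hpos _ (nlnge0 _ aI).
  have hb := hpos _ (nlnge0 _ bI).
  have [a0'|a0'] := leP a 0%R; have [b0'|b0'] := leP b 0%R.
  + by rewrite lexx (le_trans a0').
  + by rewrite (ltW hb) (le_trans a0').
  + by rewrite leNgt ha leNgt (le_lt_trans b0').
  + by rewrite hmono ?nln// lerN2 ler_ln.
- by rewrite /w lexx.
- by rewrite /w leNgt ltr01/= ln1 oppr0.
- move=> y; rewrite /= in_itv/= => /andP[y0 y1].
  have [y0'|y0'] := leP y 0%R.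
    exists 0%R; first by rewrite /= in_itv/= lexx ler01.
    by apply/eqP; rewrite /w lexx eq_le y0 y0'.
  have /hk[ky hky] : (0 < y <= 1)%R by rewrite y0' y1.
  exists (expR (- k y)); last by rewrite /w leNgt expR_gt0/= expRK opprK.
  by rewrite /= in_itv/= expR_ge0 expR_le1 oppr_le0.
- suff <- : (fun x => expeR (- psi x)) = (fun x => (F x)%:E) by [].
  by apply/funext => x; rewrite /F; have := psi0 x; case: (psi x).
Qed.

Lemma poweR_expeRN (R : realType) (t : R) (e : \bar R) :
  (0 < t)%R -> 0 <= e -> expeR (- e) `^ t = expeR (- (t%:E * e)).
Proof.
move=> t0; case: e => [r| |]//= _; first by rewrite -expRM mulrC mulrN.
by rewrite gt0_muley ?lte_fin//= powR0 ?gt_eqF.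
Qed.

Lemma ln1D_mono (R : realType) :
  {in `[0%R, +oo[ &, {mono (fun u : R => ln (1 + u)) : u v / (u <= v)%R}}.
Proof.
move=> u v; rewrite !in_itv/= !andbT => u0 v0.
by rewrite ler_ln ?posrE ?ltr_pwDl// lerD2l.
Qed.

Lemma expR_ge1 (R : realType) (a : R) : (0 <= a)%R -> (1 <= expR a)%R.
Proof. by move=> a0; rewrite -[leLHS]expR0 ler_expR. Qed.

Lemma is_df_Ggamma (R : realType) (beta : R) (psi : R -> \bar R) :
  (0 < beta)%R -> (forall x, 0 <= psi x) ->
  is_df (fun x => expeR (- psi x)) -> is_df (Ggamma_df beta psi).
Proof.
move=> beta0 psi0 dfpsi.
pose h (u : R) := ((1 + beta * ln (1 + u))^-1)%R.
(* [k] solves [h u = y] for [u]. *)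
pose k (y : R) := (expR ((y^-1 - 1) / beta) - 1)%R.
have hp (u : R) : (0 <= u)%R -> (0 < 1 + beta * ln (1 + u))%R.
  by move=> ?; rewrite ltr_pwDl// mulr_ge0 ?(ltW beta0)// ln_ge0// lerDl.
have -> : Ggamma_df beta psi =
    fun x => if psi x is r%:E then (h r)%:E else 0.
  apply/funext => x; rewrite /Ggamma_df; have := psi0 x.
  case: (psi x) => [r r0|_|//]; last by rewrite /= gt0_muley ?lte_fin.
  rewrite lee_fin in r0.
  by rewrite -EFinD lne_EFin ?ltr_pwDl// -EFinM -EFinD inver gt_eqF ?hp.
apply: (@is_df_decreasing_of_exponent _ h k) => //.
- move=> u v uI vI; have := uI; have := vI.
  rewrite !in_itv/= !andbT => u0 v0.
  by rewrite lef_pV2 ?posrE ?hp// lerD2l ler_pM2l// ln1D_mono.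
- by move=> u u0; rewrite invr_gt0 hp.
- by rewrite /h addr0 ln1 mulr0 addr0 invr1.
- move=> y /andP[y0 y1]; split.
    rewrite subr_ge0 expR_ge1 ?divr_ge0 ?(ltW beta0)// subr_ge0.
    by rewrite invf_ge1.
  rewrite /h (addrC _ (k y)) /k subrK expRK (mulrC beta) divfK ?gt_eqF//.
  by rewrite addrC subrK invrK.
Qed.

(** The distribution function [(1 + psi)^{- beta}] is max-infinitely
    divisible. *)
Lemma is_MID_Ggamma_exponent (R : realType) (beta : R) (psi : R -> \bar R) :
  (0 < beta)%R -> (forall x, 0 <= psi x) ->
  is_df (fun x => expeR (- psi x)) ->
  is_MID (fun x => expeR (- (beta%:E * lne (1 + psi x)))).
Proof.
move=> beta0 psi0 dfpsi t t0.
have tb0 : (0 < t * beta)%R by rewrite mulr_gt0.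
pose h (u : R) := expR (- (t * beta * ln (1 + u)))%R.
(* [k] solves [h u = y] for [u]. *)
pose k (y : R) := (expR (- ln y / (t * beta)) - 1)%R.
have -> : (fun x => expeR (- (beta%:E * lne (1 + psi x))) `^ t) =
    fun x => if psi x is r%:E then (h r)%:E else 0.
  apply/funext => x; rewrite poweR_expeRN//; last first.
    by rewrite mule_ge0 ?lee_fin ?(ltW beta0)// lne_ge0 leeDl.
  rewrite muleA -EFinM; have := psi0 x.
  case: (psi x) => [r r0|_|//]; last by rewrite /= gt0_muley ?lte_fin.
  rewrite lee_fin in r0.
  by rewrite -EFinD lne_EFin ?ltr_pwDl.
apply: (@is_df_decreasing_of_exponent _ h k) => //.
- by move=> u v uI vI; rewrite ler_expR lerN2 ler_pM2l// ln1D_mono.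
- by move=> u _; exact: expR_gt0.
- by rewrite /h addr0 ln1 mulr0 oppr0 expR0.
- move=> y /andP[y0 y1]; split.
    by rewrite subr_ge0 expR_ge1 ?divr_ge0 ?(ltW tb0)// oppr_ge0 ln_le0.
  rewrite /h (addrC _ (k y)) /k subrK expRK.
  by rewrite (mulrC (t * beta)%R) divfK ?gt_eqF// opprK lnK.
Qed.

Theorem theorem2p1 (R : realType) (beta : R) (hbeta : (0 < beta)%R) :
  (forall F : R -> \bar R, is_GgammaMID beta F -> is_GMID F) /\
  (forall psi : R -> \bar R,
     (forall x : R, 0 <= psi x) ->
     is_df (fun x : R => expeR (- psi x)) ->
     is_GMID (Ggamma_df beta psi)).
Proof.
suff main : forall psi : R -> \bar R, (forall x : R, 0 <= psi x) ->
    is_df (fun x : R => expeR (- psi x)) -> is_GMID (Ggamma_df beta psi).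
  split=> // F [_ [psi [psi0 dfpsi Fpsi]]].
  have -> : F = Ggamma_df beta psi by exact/funext.
  exact: main.
move=> psi psi0 dfpsi; split; first exact: is_df_Ggamma.
exists (fun x => beta%:E * lne (1 + psi x)); split=> // [x|].
  by rewrite mule_ge0 ?lee_fin ?(ltW hbeta)// lne_ge0 leeDl.
exact: is_MID_Ggamma_exponent.
Qed.
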